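(* Let $\mathcal{X}$ be the following list of three-dimensional complex associative algebras (defined explicitly in the context): $\mathfrak a_0$, $\mathfrak l_1$, $\mathfrak c_1,\dots,\mathfrak c_{11}$, $\mathfrak a_1$, $\mathfrak a_2$, $\mathfrak a_3(\kappa)$ for $\kappa\in\mathbb K$, and $\mathfrak a_4,\dots,\mathfrak a_{12}$, where $\mathbb K=\{x+yi : x,y\in\mathbb R,\ x>0 \text{ or } (x=0 \text{ and } y>0)\}\subseteq\mathbb C$. Let $D$ be the directed graph with vertex set $\mathcal X$ whose arrows are exactly the following: \begin{itemize} \item $\mathfrak c_{11}\to\mathfrak c_9$, $\mathfrak c_{11}\to\mathfrak c_{10}$; \item $\mathfrak c_{10}\to\mathfrak c_7$, $\mathfrak c_{10}\to\mathfrak c_8$; \item $\mathfrak c_9\to\mathfrak c_6$, $\mathfrak c_9\to\mathfrak c_7$, $\mathfrak c_9\to\mathfrak c_8$; \item $\mathfrak c_6\to\mathfrak c_2$, $\mathfrak c_6\to\mathfrak c_5$; $\mathfrak c_7\to\mathfrak c_5$; $\mathfrak c_8\to\mathfrak c_4$, $\mathfrak c_8\to\mathfrak c_5$; $\mathfrak c_5\to\mathfrak c_3$; \item $\mathfrak a_1\to\mathfrak a_9$, $\mathfrak a_1\to\mathfrak a_{10}$, $\mathfrak a_1\to\mathfrak c_2$; \item $\mathfrak a_{11}\to\mathfrak a_9$, $\mathfrak a_{11}\to\mathfrak a_8$, $\mathfrak a_{11}\to\mathfrak c_4$; \item $\mathfrak a_{12}\to\mathfrak a_7$, $\mathfrak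 a_{12}\to\mathfrak a_{10}$, $\mathfrak a_{12}\to\mathfrak c_4$; \item $\mathfrak a_7\to\mathfrak a_2$, $\mathfrak a_8\to\mathfrak a_2$, $\mathfrak a_9\to\mathfrak a_2$, $\mathfrak a_{10}\to\mathfrak a_2$; \item $\mathfrak a_3(\kappa)\to\mathfrak c_1$ for every $\kappa\in\mathbb K$; $\mathfrak a_3(2)\to\mathfrak l_1$; $\mathfrak a_6\to\mathfrak l_1$; \item $\mathfrak c_2\to\mathfrak c_1$, $\mathfrak c_3\to\mathfrak c_1$, $\mathfrak c_4\to\mathfrak c_1$, $\mathfrak a_2\to\mathfrak c_1$; \item $\mathfrak l_1\to\mathfrak a_0$, $\mathfrak c_1\to\mathfrak a_0$, $\mathfrak a_4\to\mathfrak a_0$, $\mathfrak a_5\to\mathfrak a_0$. \end{itemize} Then for all $\mathfrak g,\mathfrak h\in\mathcal X$, the algebra $\mathfrak g$ degenerates to $\mathfrak h$ if and only if $\mathfrak g=\mathfrak h$ or there is a directed path in $D$ from $\mathfrak g$ to $\mathfrak h$.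
   Context: Let $V$ be a complex vector space with fixed basis $(e_1,e_2,e_3)$. An algebra structure on $V$ is a $\mathbb C$-bilinear map $[\,,\,]:V\times V\to V$ (we write $uv$ for $[u,v]$). Its structure vector relative to a basis $(v_1,v_2,v_3)$ is $(\lambda_{ijk})\in\mathbb C^{27}$ where $[v_i,v_j]=\sum_k\lambda_{ijk}v_k$. Let $\boldsymbol\Lambda=\mathbb C^{27}$ be the space of all structure vectors, with the Zariski topology, and for an algebra structure $\mathfrak g$ let $\Theta(\mathfrak g)\in\boldsymbol\Lambda$ be its structure vector relative to $(e_1,e_2,e_3)$. The group $G=\mathrm{GL}(3,\mathbb C)$ acts linearly on $\boldsymbol\Lambda$ from the right by change of basis: for $g=(g_{ij})\in G$, $\boldsymbol\lambda g$ is the structure vector of $\Theta^{-1}(\boldsymbol\lambda)$ relative to the basis $(v_1,v_2,v_3)$ with $v_j=\sum_i g_{ij}e_i$. Let $O(\boldsymbol\lambda)=\boldsymbol\lambda G$ denote the orbit; orbits correspond to isomorphism classes. We say $\mathfrak g$ degenerates to $\mathfrak h$ if $\Theta(\mathfrak h)\in\overline{O(\Theta(\mathfrak g))}$ (Zariski closure). The algebras are given by their non-zero products of basis vectors (all unlisted products are zero): - $\mathfrak a_0$: all products zero. - $\mathfrak l_1$: $e_2e_3=-e_3e_2=e_1$. - $\mathfrak c_1$: $e_3e_3=e_1$. - $\mathfrak c_2$: $e_1e_1=e_1$, $e_1e_2=e_2e_1=e_2$, $e_1e_3=e_3e_1=e_3$. - $\mathfrak c_3$: $e_2e_2=e_1$,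 $e_3e_3=e_1$. - $\mathfrak c_4$: $e_1e_1=e_1$. - $\mathfrak c_5$: $e_1e_1=e_2$, $e_1e_2=e_2e_1=e_3$. - $\mathfrak c_6$: $e_1e_1=e_1$, $e_1e_2=e_2e_1=e_2$, $e_1e_3=e_3e_1=e_3$, $e_2e_2=e_3$. - $\mathfrak c_7$: $e_1e_1=e_1$, $e_1e_2=e_2e_1=e_2$. - $\mathfrak c_8$: $e_1e_1=e_1$, $e_2e_2=e_3$. - $\mathfrak c_9$: $e_1e_1=e_1$, $e_2e_2=e_2$, $e_1e_3=e_3e_1=e_3$. - $\mathfrak c_{10}$: $e_1e_1=e_1$, $e_2e_2=e_2$. - $\mathfrak c_{11}$: $e_1e_1=e_1$, $e_2e_2=e_2$, $e_3e_3=e_3$. - $\mathfrak a_1$: $e_1e_1=e_1$, $e_1e_2=e_2e_1=e_2$, $e_1e_3=e_3e_1=e_3$, $e_2e_3=-e_3e_2=e_2$, $e_3e_3=e_1$. - $\mathfrak a_2$: $e_2e_3=e_1$. - $\mathfrak a_3(\kappa)$, $\kappa\in\mathbb K$: $e_2e_2=e_1$, $e_3e_2=\kappa e_1$, $e_3e_3=e_1$. - $\mathfrak a_4$: $e_3e_1=e_1$, $e_3e_2=e_2$, $e_3e_3=e_3$. - $\mathfrak a_5$: $e_1e_3=e_1$, $e_2e_3=e_2$, $e_3e_3=e_3$. - $\mathfrak a_6$: $e_2e_1=e_1$, $e_2e_2=e_2$, $e_3e_2=e_3$. - $\mathfrak a_7$: $e_1e_2=e_2e_1=e_1$, $e_2e_2=e_2$,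 $e_3e_2=e_3$. - $\mathfrak a_8$: $e_1e_2=e_2e_1=e_1$, $e_2e_2=e_2$, $e_2e_3=e_3$. - $\mathfrak a_9$: $e_3e_2=e_2$, $e_3e_3=e_3$. - $\mathfrak a_{10}$: $e_2e_3=e_2$, $e_3e_3=e_3$. - $\mathfrak a_{11}$: $e_1e_1=e_1$, $e_3e_2=e_2$, $e_3e_3=e_3$. - $\mathfrak a_{12}$: $e_1e_1=e_1$, $e_2e_3=e_2$, $e_3e_3=e_3$. By a known classification, every three-dimensional complex associative algebra (not necessarily unital) is isomorphic to exactly one algebra in this list (different $\kappa\in\mathbb K$ giving non-isomorphic algebras), so the statement describes all degenerations inside the algebraic set of three-dimensional complex associative algebra structures. *)

(* Defs.v *)
From HB Require Import structures.
From mathcomp Require Import all_boot all_order all_algebra.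
From mathcomp Require Import reals complex mpoly.

Set Implicit Arguments.
Unset Strict Implicit.
Unset Printing Implicit Defensive.

Import GRing.Theory Num.Theory.
Local Open Scope ring_scope.

(* The Zariski topology on the affine space of functions T -> F, T finite.
   Polynomial functions have one variable per element of T, the i-th variable
   being the coordinate at [enum_val i]. *)
Section Zariski.
Variables (F : fieldType) (T : finType).

Definition polyfun (p : {mpoly F[#|T|]}) (x : {ffun T -> F}) : F :=
  p.@[fun i => x (enum_val i)].

Definition zariski_closed (Z : {ffun T -> F} -> Prop) : Prop :=
  exists S : {mpoly F[#|T|]} -> Prop,
    forall x, Z x <-> (forall p, S p -> polyfun p x = 0).

Definition zariski_closure (A : {ffun T -> F} -> Prop) (x : {ffun T -> F}) :
    Prop :=
  forall Z, zariski_closed Z -> (forall y, A y -> Z y) -> Z x.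

End Zariski.

(* [l (i, j, k)] is the coefficient of v_k in the product [v_i, v_j];
   indices are 0, 1, 2 instead of 1, 2, 3. *)
Definition structure_space (F : fieldType) : Type :=
  {ffun 'I_3 * 'I_3 * 'I_3 -> F}.

Section StructureVectors.
Variables (F : fieldType) (V : vectType F).

Definition structure_vector (v : 3.-tuple V) (mu : {bilinear V -> V -> V}) :
    structure_space F :=
  [ffun t : 'I_3 * 'I_3 * 'I_3 => coord v t.2 (mu v`_t.1.1 v`_t.1.2)].

Definition algebra_fun (e : 3.-tuple V) (l : structure_space F) (x y : V) : V :=
  \sum_i \sum_j \sum_k (coord e i x * coord e j y * l (i, j, k)) *: e`_k.

Fact algebra_fun_bilinear e l : bilinear_for *:%R *:%R (algebra_fun e l).
Proof.
split=> z a x y; rewrite /algebra_fun /= scaler_sumr -big_split /=;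
  apply: eq_bigr => i _; rewrite scaler_sumr -big_split /=;
  apply: eq_bigr => j _; rewrite scaler_sumr -big_split /=;
  apply: eq_bigr => k _; rewrite linearP /= scalerA -scalerDl; congr (_ *: _).
- by rewrite !mulrDl !mulrA.
- by rewrite mulrDr mulrDl mulrCA !mulrA.
Qed.

HB.instance Definition _ e l :=
  bilinear_isBilinear.Build F V V V *:%R *:%R (algebra_fun e l)
    (algebra_fun_bilinear e l).

(* When e is a basis, this is the inverse of [structure_vector e]. *)
Definition algebra_of (e : 3.-tuple V) (l : structure_space F) :
    {bilinear V -> V -> V} := algebra_fun e l.

Definition new_basis (e : 3.-tuple V) (g : 'M[F]_3) : 3.-tuple V :=
  [tuple \sum_i g i j *: e`_i | j < 3].

Definition change_basis (e : 3.-tuple V) (l : structure_space F)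
    (g : 'M[F]_3) : structure_space F :=
  structure_vector (new_basis e g) (algebra_of e l).

Definition orbit_of (e : 3.-tuple V) (l m : structure_space F) : Prop :=
  exists2 g : 'M[F]_3, g \in unitmx & m = change_basis e l g.

Definition degenerates (e : 3.-tuple V) (mu nu : {bilinear V -> V -> V}) :
    Prop :=
  zariski_closure (orbit_of e (structure_vector e mu)) (structure_vector e nu).

End StructureVectors.

Section TheAlgebras.
Variable R : realType.
Local Notation C := (R[i]).

Definition inK (z : C) : bool :=
  (0 < complex.Re z) || (complex.Re z == 0) && (0 < complex.Im z).

Inductive alg3 : Type :=
  | A0 | L1
  | C1 | C2 | C3 | C4 | C5 | C6 | C7 | C8 | C9 | C10 | C11
  | A1 | A2 | A3 of {kappa : C | inK kappa}
  | A4 | A5 | A6 | A7 | A8 | A9 | A10 | A11 | A12.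

(* [en i j k c] says that the product e_i e_j has component c along e_k, with
   indices starting at 1. *)
Local Notation en i j k c := (i%N, j%N, k%N, c%R).

Definition products (x : alg3) : seq (nat * nat * nat * C) :=
  match x with
  | A0 => [::]
  | L1 => [:: en 2 3 1 1; en 3 2 1 (-1)]
  | C1 => [:: en 3 3 1 1]
  | C2 => [:: en 1 1 1 1; en 1 2 2 1; en 2 1 2 1; en 1 3 3 1; en 3 1 3 1]
  | C3 => [:: en 2 2 1 1; en 3 3 1 1]
  | C4 => [:: en 1 1 1 1]
  | C5 => [:: en 1 1 2 1; en 1 2 3 1; en 2 1 3 1]
  | C6 => [:: en 1 1 1 1; en 1 2 2 1; en 2 1 2 1; en 1 3 3 1;
              en 3 1 3 1; en 2 2 3 1]
  | C7 => [:: en 1 1 1 1; en 1 2 2 1; en 2 1 2 1]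
  | C8 => [:: en 1 1 1 1; en 2 2 3 1]
  | C9 => [:: en 1 1 1 1; en 2 2 2 1; en 1 3 3 1; en 3 1 3 1]
  | C10 => [:: en 1 1 1 1; en 2 2 2 1]
  | C11 => [:: en 1 1 1 1; en 2 2 2 1; en 3 3 3 1]
  | A1 => [:: en 1 1 1 1; en 1 2 2 1; en 2 1 2 1; en 1 3 3 1;
              en 3 1 3 1; en 2 3 2 1; en 3 2 2 (-1); en 3 3 1 1]
  | A2 => [:: en 2 3 1 1]
  | A3 kappa => [:: en 2 2 1 1; en 3 2 1 (val kappa); en 3 3 1 1]
  | A4 => [:: en 3 1 1 1; en 3 2 2 1; en 3 3 3 1]
  | A5 => [:: en 1 3 1 1; en 2 3 2 1; en 3 3 3 1]
  | A6 => [:: en 2 1 1 1; en 2 2 2 1; en 3 2 3 1]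
  | A7 => [:: en 1 2 1 1; en 2 1 1 1; en 2 2 2 1; en 3 2 3 1]
  | A8 => [:: en 1 2 1 1; en 2 1 1 1; en 2 2 2 1; en 2 3 3 1]
  | A9 => [:: en 3 2 2 1; en 3 3 3 1]
  | A10 => [:: en 2 3 2 1; en 3 3 3 1]
  | A11 => [:: en 1 1 1 1; en 3 2 2 1; en 3 3 3 1]
  | A12 => [:: en 1 1 1 1; en 2 3 2 1; en 3 3 3 1]
  end.

Definition alg3_vector (x : alg3) : structure_space C :=
  [ffun t : 'I_3 * 'I_3 * 'I_3 =>
     \sum_(p <- products x | p.1 == (t.1.1.+1, t.1.2.+1, t.2.+1)) p.2].

Definition alg3_algebra (V : vectType C) (e : 3.-tuple V) (x : alg3) :
    {bilinear V -> V -> V} := algebra_of e (alg3_vector x).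

Definition arrow (x y : alg3) : bool :=
  match x, y with
  | C11, (C9 | C10)
  | C10, (C7 | C8)
  | C9, (C6 | C7 | C8)
  | C6, (C2 | C5)
  | C7, C5
  | C8, (C4 | C5)
  | C5, C3
  | A1, (A9 | A10 | C2)
  | A11, (A9 | A8 | C4)
  | A12, (A7 | A10 | C4)
  | A7, A2
  | A8, A2
  | A9, A2
  | A10, A2
  | A3 _, C1 => true
  | A3 kappa, L1 => val kappa == 2
  | A6, L1
  | C2, C1
  | C3, C1
  | C4, C1
  | A2, C1
  | L1, A0
  | C1, A0
  | A4, A0
  | A5, A0 => true
  | _, _ => false
  end.

Definition directed_path (x y : alg3) : Prop :=
  exists p : seq alg3, [/\ (0 < size p)%N, path arrow x p & last x p = y].

End TheAlgebras.

(* Main.v *)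
Require Import Defs.
From mathcomp Require Import all_boot all_order all_algebra.
From mathcomp Require Import reals complex mpoly ring.

Set Implicit Arguments.
Unset Strict Implicit.
Unset Printing Implicit Defensive.

Import Order.TTheory GRing.Theory Num.Theory.
Local Open Scope ring_scope.

(** The closure of an orbit is tested on polynomials: [m] lies in the closure of
    the orbit of [l] exactly when every polynomial vanishing on the orbit
    vanishes at [m] ([zariski_closureP]).  As the group acts by polynomial
    maps, degeneration is transitive ([in_orbit_closure_trans]), so it is
    enough to realise the arrows of the graph and to obstruct a few pairs.

    Arrows.  Suppose that for every [t != 0] some basis [v(t)] of [g] has the
    products of [h] plus terms divisible by [t].  A polynomial vanishing on the
    orbit of [g], evaluated along this curve, is a polynomial in [t] with
    infinitely many zeros, hence vanishes at [t = 0], that is at [h]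
    ([degeneration]).  The bases are listed in [contract].

    Obstructions.  An expression in products of vectors, covectors and the
    traces of left and right multiplications has a basis-free meaning; if it
    vanishes identically on [g] it vanishes identically on every degeneration
    of [g] ([satisfies_closure]).  Write [t] and [s] for the linear forms
    [x |-> tr L_x] and [x |-> tr R_x].  The invariants are:
    commutativity; linear relations between [t] and [s], and multiplicativity
    of a combination of them; the assertion that the bilinear map
    [n xy - psi(x) y - phi(y) x], for given combinations [psi] and [phi] of [t]
    and [s], is zero, or that its components have rank at most one; [xyz = 0];
    [n xx = a t(x) x]; the vanishing of the determinant, or of the discriminant
    of the characteristic polynomial, of [L_x]; and, for the family [A3 kappa],
    where [xy = B(x, y) e1] for a bilinear form [B], the ratio of
    [(B(x, y) - B(y, x))^2] to the Gram determinant of [B], which is [kappa^2]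
    and determines [kappa] inside the half plane [inK].

    By transitivity it is enough to separate each [g] from the minimal
    algebras that are not below it ([separated]); that these suffice is a
    finite search in the graph ([separated_or_below]). *)

(** * Algebras of functions and substitution into polynomials *)

Section FunctionAlgebras.
Variables (F : fieldType) (X : Type).

(** Stated for a predicate on functions, so that one substitution lemma serves
    both for polynomial functions of a structure vector and for polynomials in
    the parameter of a curve. *)
Record function_algebra (P : (X -> F) -> Prop) : Prop := FunctionAlgebra {
  falg_ext : forall f g, f =1 g -> P f -> P g;
  falg_const : forall c, P (fun=> c);
  falg_add : forall f g, P f -> P g -> P (fun x => f x + g x);
  falg_mul : forall f g, P f -> P g -> P (fun x => f x * g x)
}.

Variables (P : (X -> F) -> Prop) (algP : function_algebra P).

Lemma falg_sum (I : Type) (r : seq I) (Q : pred I) (f : I -> X -> F) :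
  (forall i, P (f i)) -> P (fun x => \sum_(i <- r | Q i) f i x).
Proof.
move=> Pf; elim: r => [|i r IHr].
  by apply: (falg_ext algP) (falg_const algP 0) => x; rewrite big_nil.
apply: (falg_ext algP (f := fun x =>
  (if Q i then f i x else 0) + \sum_(j <- r | Q j) f j x)).
  by move=> x; rewrite big_cons; case: ifP; rewrite ?add0r.
by apply: (falg_add algP) => //; case: (Q i) => //; apply: (falg_const algP).
Qed.

Lemma falg_prod (I : Type) (r : seq I) (f : I -> X -> F) :
  (forall i, P (f i)) -> P (fun x => \prod_(i <- r) f i x).
Proof.
move=> Pf; elim: r => [|i r IHr].
  by apply: (falg_ext algP) (falg_const algP 1) => x; rewrite big_nil.
apply: (falg_ext algP (f := fun x => f i x * \prod_(j <- r) f j x)).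
  by move=> x; rewrite big_cons.
exact: falg_mul.
Qed.

Lemma falg_exp (f : X -> F) n : P f -> P (fun x => f x ^+ n).
Proof.
move=> Pf.
apply: (falg_ext algP (f := fun x => \prod_(i <- nseq n tt) f x)).
  by move=> x; rewrite big_const_seq count_predT size_nseq iter_mulr_1.
exact: falg_prod.
Qed.

Lemma falg_polyfun (T : finType) (p : {mpoly F[#|T|]}) (y : X -> {ffun T -> F}) :
  (forall i, P (fun x => y x i)) -> P (fun x => polyfun p (y x)).
Proof.
move=> Py; apply: (falg_ext algP (f := fun x => \sum_(m <- msupp p)
   p@_m * \prod_(i <- index_enum 'I_#|T|) y x (enum_val i) ^+ m i)).
  by move=> x; rewrite /polyfun mevalE.
apply: falg_sum => m; apply: (falg_mul algP); first exact: falg_const algP _.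
by apply: falg_prod => i; exact: falg_exp.
Qed.

End FunctionAlgebras.

(** * The Zariski closure *)

Section Closure.
Variables (F : fieldType) (T : finType).
Implicit Types (A : {ffun T -> F} -> Prop) (x : {ffun T -> F}).

Definition regular (f : {ffun T -> F} -> F) : Prop :=
  exists p : {mpoly F[#|T|]}, forall x, polyfun p x = f x.

Lemma regular_algebra : function_algebra regular.
Proof.
split=> [f g fg [p pf]|c|f g [p pf] [q qg]|f g [p pf] [q qg]].
- by exists p => x; rewrite pf fg.
- by exists c%:MP => x; rewrite /polyfun mevalC.
- by exists (p + q) => x; rewrite -pf -qg /polyfun mevalD.
- by exists (p * q) => x; rewrite -pf -qg /polyfun mevalM.
Qed.

Lemma regular_coord i : regular (fun x => x i).
Proof. by exists 'X_(enum_rank i) => x; rewrite /polyfun mevalXU enum_rankK. Qed.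

Lemma zariski_closureP A x : zariski_closure A x <->
  forall p, (forall y, A y -> polyfun p y = 0) -> polyfun p x = 0.
Proof.
split=> [clAx p pA | Ax Z [S ZS] AZ].
  apply: (clAx (fun y => polyfun p y = 0)) => //.
  by exists (fun q => q = p) => y; split=> [py _ ->|]; last exact.
by apply/ZS => p Sp; apply: Ax => y /AZ /ZS; apply.
Qed.

Lemma regular_closure A x f : zariski_closure A x -> regular f ->
  (forall y, A y -> f y = 0) -> f x = 0.
Proof.
move=> /zariski_closureP Ax [p pf] fA; rewrite -pf; apply: Ax => y Ay.
by rewrite pf fA.
Qed.

End Closure.

Section Curves.
Variable F : numFieldType.

Lemma horner_algebra : function_algebra
  (fun f : F -> F => exists q : {poly F}, forall t, q.[t] = f t).
Proof.
split=> [f g fg [p pf]|c|f g [p pf] [q qg]|f g [p pf] [q qg]].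
- by exists p => x; rewrite pf fg.
- by exists c%:P => x; rewrite hornerC.
- by exists (p + q) => x; rewrite -pf -qg hornerD.
- by exists (p * q) => x; rewrite -pf -qg hornerM.
Qed.

(** In characteristic zero [q] would have the pairwise distinct roots
    [1, 2, 3, ...]. *)
Lemma punctured_root (q : {poly F}) :
  (forall t, t != 0 -> q.[t] = 0) -> q.[0] = 0.
Proof.
move=> q0; have [->|qn0] := eqVneq q 0; first by rewrite horner0.
pose rs : seq F := [seq n.+1%:R | n <- iota 0 (size q)].
suff : (size rs < size q)%N by rewrite size_map size_iota ltnn.
apply: max_poly_roots => //.
  by apply/allP => _ /mapP[n _ ->]; rewrite rootE q0 // pnatr_eq0.
by rewrite map_inj_uniq ?iota_uniq // => m n /eqP; rewrite eqr_nat => /eqP[].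
Qed.

(** A polynomial composed with the curve is a polynomial in [t], to which
    [punctured_root] applies. *)
Lemma curve_closure (T : finType) (A : {ffun T -> F} -> Prop)
    (c : F -> {ffun T -> F}) :
  (forall i, exists q : {poly F}, forall t, q.[t] = c t i) ->
  (forall t, t != 0 -> A (c t)) -> zariski_closure A (c 0).
Proof.
move=> cpoly cA; apply/zariski_closureP => p pA.
have [q qc] := falg_polyfun horner_algebra p cpoly.
by rewrite -qc; apply: punctured_root => t t0; rewrite qc pA //; apply: cA.
Qed.

End Curves.

(** * Algebras on column vectors *)

Section MatrixModel.
Variable F : fieldType.
Implicit Types (l m : structure_space F) (x y : 'cV[F]_3) (h : 'M[F]_3).

Definition left_mx l x : 'M[F]_3 := \matrix_(k, j) \sum_i x i 0 * l (i, j, k).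
Definition right_mx l y : 'M[F]_3 := \matrix_(k, i) \sum_j y j 0 * l (i, j, k).
Definition vmul l x y : 'cV[F]_3 := left_mx l x *m y.

Lemma vmulE l x y k :
  vmul l x y k 0 = \sum_i \sum_j x i 0 * y j 0 * l (i, j, k).
Proof.
rewrite mxE exchange_big; apply: eq_bigr => j _; rewrite mxE mulr_suml.
by apply: eq_bigr => i _; rewrite mulrAC.
Qed.

Lemma vmul_right l x y : vmul l x y = right_mx l y *m x.
Proof.
apply/colP => k; rewrite vmulE mxE; apply: eq_bigr => i _.
by rewrite mxE mulr_suml; apply: eq_bigr => j _; rewrite mulrAC mulrC mulrA mulrAC.
Qed.

Lemma vmul_suml l (I : finType) (a : I -> F) (u : I -> 'cV[F]_3) y :
  vmul l (\sum_i a i *: u i) y = \sum_i a i *: vmul l (u i) y.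
Proof.
rewrite vmul_right mulmx_sumr; apply: eq_bigr => i _.
by rewrite -scalemxAr -vmul_right.
Qed.

Lemma vmul_sumr l (I : finType) (a : I -> F) (u : I -> 'cV[F]_3) x :
  vmul l x (\sum_i a i *: u i) = \sum_i a i *: vmul l x (u i).
Proof.
by rewrite /vmul mulmx_sumr; apply: eq_bigr => i _; rewrite -scalemxAr.
Qed.

(** The structure vector of [vmul l] relative to the columns of [h]. *)
Definition act l h : structure_space F := [ffun t : 'I_3 * 'I_3 * 'I_3 =>
  (invmx h *m vmul l (col t.1.1 h) (col t.1.2 h)) t.2 0].

Lemma mulmx_col_sum h x : h *m x = \sum_i x i 0 *: col i h.
Proof.
apply/colP => k; rewrite mxE summxE; apply: eq_bigr => i _.
by rewrite !mxE mulrC.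
Qed.

(** [h] is an isomorphism from [act l h] to [l]; by [act_unique] this
    characterises [act l h]. *)
Lemma vmul_act l h x y : h \in unitmx ->
  vmul l (h *m x) (h *m y) = h *m vmul (act l h) x y.
Proof.
move=> hU; rewrite -[LHS](mulKVmx hU); congr (h *m _).
rewrite (mulmx_col_sum h x) (mulmx_col_sum h y) vmul_suml mulmx_sumr.
apply/colP => k.
rewrite vmulE summxE; apply: eq_bigr => i _.
rewrite vmul_sumr scaler_sumr mulmx_sumr summxE; apply: eq_bigr => j _.
by rewrite ffunE /= -!scalemxAr !mxE mulrA.
Qed.

Lemma act_unique l m h : h \in unitmx ->
  (forall x y, vmul l (h *m x) (h *m y) = h *m vmul m x y) -> m = act l h.
Proof.
move=> hU lm; apply/ffunP => -[[a b] c]; rewrite ffunE /=.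
rewrite !colE lm mulKmx // vmulE (bigD1 a) //= (bigD1 b) //=.
rewrite !mxE !eqxx !mulr1 mul1r big1 ?addr0 => [|j /negPf jb]; last first.
  by rewrite !mxE jb /= mulr0 mul0r.
rewrite big1 ?addr0 // => i /negPf ia; apply: big1 => j _.
by rewrite !mxE ia /= !mul0r.
Qed.

Lemma act_comp l h1 h2 : h1 \in unitmx -> h2 \in unitmx ->
  act (act l h1) h2 = act l (h1 *m h2).
Proof.
move=> U1 U2; apply: act_unique; first by rewrite unitmx_mul U1 U2.
by move=> x y; rewrite -!mulmxA vmul_act // vmul_act.
Qed.

Lemma regular_vmul x y k : regular (fun l => vmul l x y k 0).
Proof.
have alg := regular_algebra F ('I_3 * 'I_3 * 'I_3)%type.
apply: (falg_ext alg (fun l => esym (vmulE l x y k))).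
apply: (falg_sum alg) => i; apply: (falg_sum alg) => j.
by apply: (falg_mul alg); [exact: falg_const alg _ | exact: regular_coord].
Qed.

Lemma regular_act h t : regular (fun l => act l h t).
Proof.
have alg := regular_algebra F ('I_3 * 'I_3 * 'I_3)%type.
apply: (falg_ext alg (f := fun l =>
  \sum_j invmx h t.2 j * vmul l (col t.1.1 h) (col t.1.2 h) j 0)).
  by move=> l; rewrite ffunE mxE.
apply: (falg_sum alg) => j.
by apply: (falg_mul alg); [exact: falg_const alg _ | exact: regular_vmul].
Qed.

Definition in_orbit l m := exists2 h, h \in unitmx & m = act l h.

(** If [p] vanishes on the orbit of [l], so does [p (act _ h)] for every
    invertible [h], hence the latter vanishes at [m]; thus [p] vanishes on the
    orbit of [m] and so at [n]. *)
Lemma in_orbit_closure_trans l m n :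
  zariski_closure (in_orbit l) m -> zariski_closure (in_orbit m) n ->
  zariski_closure (in_orbit l) n.
Proof.
move=> lm mn; apply/zariski_closureP => p pl.
move/zariski_closureP: mn; apply=> _ [h hU ->].
apply: (regular_closure lm (f := fun l => polyfun p (act l h))).
  by apply: (falg_polyfun (regular_algebra _ _)) => t; exact: regular_act.
move=> _ [h1 U1 ->]; apply: pl; rewrite act_comp //.
by exists (h1 *m h) => //; rewrite unitmx_mul U1 hU.
Qed.

Lemma in_orbit_refl l : in_orbit l l.
Proof.
exists 1%:M; first exact: unitmx1.
by apply: act_unique; rewrite ?unitmx1 // => x y; rewrite !mul1mx.
Qed.

End MatrixModel.

(** * Coordinates in a vector space with a basis *)

Section ChangeOfBasis.
Variables (F : fieldType) (V : vectType F) (e : 3.-tuple V).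
Hypothesis he : basis_of fullv e.
Implicit Types (l m : structure_space F) (x y : 'cV[F]_3) (h : 'M[F]_3).

Definition vec x : V := \sum_i x i 0 *: e`_i.

Lemma coord_vec i x : coord e i (vec x) = x i 0.
Proof. by rewrite coord_sum_free // (basis_free he). Qed.

Lemma algebra_fun_vec l x y : algebra_fun e l (vec x) (vec y) = vec (vmul l x y).
Proof.
rewrite /vec; under [RHS]eq_bigr => k _ do rewrite vmulE scaler_suml.
rewrite /algebra_fun [RHS]exchange_big; apply: eq_bigr => i _.
under [RHS]eq_bigr => k _ do rewrite scaler_suml.
rewrite [RHS]exchange_big; apply: eq_bigr => j _; apply: eq_bigr => k _.
by rewrite !coord_vec.
Qed.

Lemma new_basis_vec h (i : 'I_3) : (new_basis e h)`_i = vec (col i h).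
Proof.
by rewrite -tnth_nth tnth_mktuple; apply: eq_bigr => j _; rewrite mxE.
Qed.

Lemma vec_mulmx h x : vec (h *m x) = \sum_i x i 0 *: (new_basis e h)`_i.
Proof.
rewrite /vec; under [RHS]eq_bigr => i _ do rewrite new_basis_vec scaler_sumr.
rewrite [RHS]exchange_big; apply: eq_bigr => k _; rewrite mxE scaler_suml.
by apply: eq_bigr => i _; rewrite scalerA mxE mulrC.
Qed.

Lemma vec_coord (v : V) : v = vec (\col_i coord e i v).
Proof.
rewrite {1}(coord_basis he (memvf v)).
by apply: eq_bigr => i _; rewrite mxE.
Qed.

Lemma new_basis_free h : h \in unitmx -> free (new_basis e h).
Proof.
move=> hU; have : basis_of fullv (new_basis e h).
  rewrite basisEdim size_tuple; apply/andP; split; last first.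
    by move/vector.size_basis: (he) => ->.
  apply/subvP => v _; rewrite (vec_coord v) -[X in vec X](mulKVmx hU) vec_mulmx.
  apply: rpred_sum => i _; apply/rpredZ/memv_span/mem_nth.
  by rewrite size_tuple.
exact: basis_free.
Qed.

Lemma change_basis_act l h : h \in unitmx -> change_basis e l h = act l h.
Proof.
move=> hU; apply/ffunP => -[[a b] c]; rewrite !ffunE /=.
rewrite !new_basis_vec algebra_fun_vec -{1}[vmul _ _ _](mulKVmx hU) vec_mulmx.
by rewrite coord_sum_free // new_basis_free.
Qed.

Lemma structure_vector_algebra_of l : structure_vector e (algebra_of e l) = l.
Proof.
(* This is [change_basis_act] for the identity matrix. *)
rewrite [RHS](act_unique (l := l) (unitmx1 F 3)); last first.
  by move=> x y; rewrite !mul1mx.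
rewrite -change_basis_act ?unitmx1 // /change_basis.
congr (structure_vector _ _).
apply: eq_from_tnth => i; rewrite !(tnth_nth 0) new_basis_vec.
rewrite /vec (bigD1 i) //= !mxE eqxx scale1r big1 ?addr0 // => j /negPf ji.
by rewrite !mxE ji scale0r.
Qed.

End ChangeOfBasis.

(** * Invariant polynomials *)

(** Expressions built from vector variables, covector variables (numbered by
    the first argument of [Pair]), products and traces of multiplications.
    Being a syntax, it gives polynomiality and invariance of all of them by one
    induction. *)
Inductive vterm : Type := Var of nat | Prod of vterm & vterm.

Inductive sterm (F : Type) : Type :=
  | Cst of F
  | Pair of nat & vterm
  | TrL of vterm
  | TrR of vterm
  | Add of sterm F & sterm F
  | Mul of sterm F & sterm F.

(** Evaluation is abstract in the carrier: it is used with matrices to prove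
    invariance and with triples of scalars to compute. *)
Section Evaluation.
Variables (F : fieldType) (W W' : Type).
Variables (mul : W -> W -> W) (pair : W' -> W -> F) (trl trr : W -> F).
Variables (x : nat -> W) (xi : nat -> W').

Fixpoint veval (u : vterm) : W :=
  match u with Var i => x i | Prod u1 u2 => mul (veval u1) (veval u2) end.

Fixpoint seval (f : sterm F) : F :=
  match f with
  | Cst c => c
  | Pair i u => pair (xi i) (veval u)
  | TrL u => trl (veval u)
  | TrR u => trr (veval u)
  | Add f1 f2 => seval f1 + seval f2
  | Mul f1 f2 => seval f1 * seval f2
  end.

End Evaluation.

Lemma eq_seval (F : fieldType) (W W' : Type) (mul : W -> W -> W)
    (pair : W' -> W -> F) (trl trr : W -> F) x y xi eta (f : sterm F) :
  x =1 y -> xi =1 eta ->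
  seval mul pair trl trr x xi f = seval mul pair trl trr y eta f.
Proof.
move=> xy xieta.
have eq_veval u : veval mul x u = veval mul y u.
  by elim: u => [i|u IHu v IHv] /=; rewrite ?xy // IHu IHv.
by elim: f => [//|i u|u|u|f IHf g IHg|f IHf g IHg] /=;
  rewrite ?IHf ?IHg // eq_veval // xieta.
Qed.

Section Invariants.
Variable F : fieldType.
Implicit Types (l m : structure_space F) (h : 'M[F]_3) (f : sterm F).
Implicit Types (x : nat -> 'cV[F]_3) (xi : nat -> 'rV[F]_3).

Definition mx_veval l x := veval (vmul l) x.
Definition mx_seval l x xi f : F :=
  seval (vmul l) (fun u v => (u *m v) 0 0) (fun v => \tr (left_mx l v))
    (fun v => \tr (right_mx l v)) x xi f.

Definition satisfies l f : Prop := forall x xi, mx_seval l x xi f = 0.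

Let alg := regular_algebra F ('I_3 * 'I_3 * 'I_3)%type.

Lemma regular_mx_veval x u k : regular (fun l => mx_veval l x u k 0).
Proof.
elim: u k => [i|u IHu v IHv] k; first exact: falg_const alg _.
apply: (falg_ext alg (fun l => esym (vmulE l _ _ k))).
do 2!apply: (falg_sum alg) => ?.
apply: (falg_mul alg); last exact: regular_coord.
exact: (falg_mul alg).
Qed.

Lemma regular_mx_seval x xi f : regular (fun l => mx_seval l x xi f).
Proof.
elim: f => [c|i u|u|u|f IHf g IHg|f IHf g IHg].
- exact: falg_const alg _.
- apply: (falg_ext alg (fun l => esym (mxE _ _ _ _))).
  apply: (falg_sum alg) => k; apply: (falg_mul alg (falg_const alg _)).
  exact: regular_mx_veval.
- apply: (falg_sum alg) => k; apply: (falg_ext alg (fun l => esym (mxE _ _ _ _))).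
  apply: (falg_sum alg) => i; apply: (falg_mul alg); last exact: regular_coord.
  exact: regular_mx_veval.
- apply: (falg_sum alg) => k; apply: (falg_ext alg (fun l => esym (mxE _ _ _ _))).
  apply: (falg_sum alg) => i; apply: (falg_mul alg); last exact: regular_coord.
  exact: regular_mx_veval.
- exact: (falg_add alg).
- exact: (falg_mul alg).
Qed.

Lemma eq_mulmx_col (A B : 'M[F]_3) :
  (forall v : 'cV[F]_3, A *m v = B *m v) -> A = B.
Proof.
by move=> AB; apply/matrixP => i j; have := AB (delta_mx j 0);
  rewrite -!colE => /colP/(_ i); rewrite !mxE.
Qed.

(** Traces of multiplications are invariant because an isomorphism [h] conjugates
    the multiplication operators. *)
Lemma mxtrace_conj (A B h : 'M[F]_3) : h \in unitmx ->
  A *m h = h *m B -> \tr A = \tr B.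
Proof. by move=> hU AB; rewrite -(mulmxK hU A) AB mxtrace_mulC mulKmx. Qed.

Lemma mx_veval_act l h x u : h \in unitmx ->
  h *m mx_veval (act l h) x u = mx_veval l (fun i => h *m x i) u.
Proof.
move=> hU; elim: u => [//|u IHu v IHv].
by rewrite /mx_veval /= -!/(mx_veval _ _ _) -IHu -IHv vmul_act.
Qed.

Lemma mx_seval_act l h x xi f : h \in unitmx ->
  mx_seval (act l h) x xi f =
  mx_seval l (fun i => h *m x i) (fun i => xi i *m invmx h) f.
Proof.
move=> hU; rewrite /mx_seval.
elim: f => [//|i u|u|u|f IHf g IHg|f IHf g IHg] /=; rewrite ?IHf ?IHg //;
  rewrite -!/(mx_veval _ _ _) -mx_veval_act //.
- by rewrite -mulmxA mulKmx.
- apply/esym/(mxtrace_conj hU)/eq_mulmx_col => v.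
  by rewrite -!mulmxA -[LHS]/(vmul _ _ _) vmul_act.
- apply/esym/(mxtrace_conj hU)/eq_mulmx_col => v.
  by rewrite -!mulmxA -!vmul_right vmul_act.
Qed.

(** On the orbit of [l] the expression takes, up to renaming its variables by
    [h], the values that it takes on [l]. *)
Lemma satisfies_closure l m f :
  zariski_closure (in_orbit l) m -> satisfies l f -> satisfies m f.
Proof.
move=> lm lf x xi; apply: (regular_closure lm (regular_mx_seval x xi f)).
by move=> _ [h hU ->]; rewrite mx_seval_act.
Qed.

End Invariants.

(** * Computation from a list of products *)

Section Coordinates.
Variable F : fieldType.
Local Notation product := (nat * nat * nat * F)%type.
Implicit Types (ps : seq product) (x y : F * F * F).

(** Indices start at 1, as in lists of products; other indices give the default
    value, so that they contribute nothing to a product. *)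
Definition proj3 (T : Type) (d : T) (v : T * T * T) (i : nat) : T :=
  match i with 1 => v.1.1 | 2 => v.1.2 | 3 => v.2 | _ => d end.

Definition at3 (i : nat) (a : F) : F * F * F :=
  match i with 1 => (a, 0, 0) | 2 => (0, a, 0) | 3 => (0, 0, a)
  | _ => (0, 0, 0) end.

Definition add3 x y : F * F * F := (x.1.1 + y.1.1, x.1.2 + y.1.2, x.2 + y.2).

Definition tmul ps x y : F * F * F :=
  foldr (fun p => add3
    (at3 p.1.2 (p.2 * proj3 0 x p.1.1.1 * proj3 0 y p.1.1.2))) (0, 0, 0) ps.

Definition tpair x y : F := x.1.1 * y.1.1 + x.1.2 * y.1.2 + x.2 * y.2.

Definition ttrl ps x : F :=
  foldr (fun p r => proj3 0 (at3 p.1.2 (p.2 * proj3 0 x p.1.1.1)) p.1.1.2 + r)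
    0 ps.

Definition ttrr ps y : F :=
  foldr (fun p r => proj3 0 (at3 p.1.2 (p.2 * proj3 0 y p.1.1.2)) p.1.1.1 + r)
    0 ps.

Definition teval ps := seval (tmul ps) tpair (ttrl ps) (ttrr ps).

Definition table ps : structure_space F := [ffun t : 'I_3 * 'I_3 * 'I_3 =>
  \sum_(p <- ps | p.1 == (t.1.1.+1, t.1.2.+1, t.2.+1)) p.2].

Definition col3 x : 'cV[F]_3 := \col_(k < 3) proj3 0 x k.+1.
Definition row3 x : 'rV[F]_3 := \row_(k < 3) proj3 0 x k.+1.

Lemma col3K (v : 'cV[F]_3) : v = col3 (v 0 0, v 1 0, v 2 0).
Proof.
apply/colP => i; rewrite mxE.
by case: i => -[|[|[|//]]] lt_i /=; congr (v _ _); apply: val_inj.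
Qed.

Lemma row3K (v : 'rV[F]_3) : v = row3 (v 0 0, v 0 1, v 0 2).
Proof.
apply/rowP => i; rewrite mxE.
by case: i => -[|[|[|//]]] lt_i /=; congr (v _ _); apply: val_inj.
Qed.

Lemma tableE ps i j k : table ps (i, j, k) =
  \sum_(p <- ps) p.2 * (p.1.1.1 == i.+1)%:R * (p.1.1.2 == j.+1)%:R
    * (p.1.2 == k.+1)%:R.
Proof.
rewrite ffunE /= big_mkcond; apply: eq_bigr => -[[[a b] c] r] _ /=.
rewrite !xpair_eqE.
by do 3!case: eqP => _ /=; rewrite ?mulr1 ?mulr0 ?mul0r.
Qed.

Lemma sum_proj3 x a : \sum_(i < 3) (a == i.+1)%:R * proj3 0 x i.+1 = proj3 0 x a.
Proof.
rewrite !big_ord_recl big_ord0 /=.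
by case: a => [|[|[|[|a]]]] /=; rewrite ?mul0r ?mul1r ?addr0 ?add0r.
Qed.

Lemma proj3_at3 k a (i : 'I_3) : proj3 0 (at3 k a) i.+1 = a * (k == i.+1)%:R.
Proof.
by case: k => [|[|[|[|k]]]]; case: i => -[|[|[|//]]] ? /=; rewrite ?mulr0 ?mulr1.
Qed.

Lemma proj3_add3 x y i : proj3 0 (add3 x y) i = proj3 0 x i + proj3 0 y i.
Proof. by case: i => [|[|[|[|i]]]] //=; rewrite addr0. Qed.

Lemma left_mx_table ps x k j : left_mx (table ps) (col3 x) k j =
  \sum_(p <- ps) p.2 * proj3 0 x p.1.1.1 * (p.1.1.2 == j.+1)%:R
    * (p.1.2 == k.+1)%:R.
Proof.
rewrite mxE; under eq_bigr => i _ do rewrite mxE tableE mulr_sumr.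
rewrite exchange_big; apply: eq_bigr => p _.
rewrite -[proj3 0 x p.1.1.1]sum_proj3 mulr_sumr !mulr_suml.
by apply: eq_bigr => i _; ring.
Qed.

Lemma right_mx_table ps y k i : right_mx (table ps) (col3 y) k i =
  \sum_(p <- ps) p.2 * proj3 0 y p.1.1.2 * (p.1.1.1 == i.+1)%:R
    * (p.1.2 == k.+1)%:R.
Proof.
rewrite mxE; under eq_bigr => j _ do rewrite mxE tableE mulr_sumr.
rewrite exchange_big; apply: eq_bigr => p _.
rewrite -[proj3 0 y p.1.1.2]sum_proj3 mulr_sumr !mulr_suml.
by apply: eq_bigr => j _; ring.
Qed.

Lemma vmul_table ps x y : vmul (table ps) (col3 x) (col3 y) = col3 (tmul ps x y).
Proof.
apply/colP => k; rewrite !mxE.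
transitivity (\sum_(p <- ps)
    p.2 * proj3 0 x p.1.1.1 * proj3 0 y p.1.1.2 * (p.1.2 == k.+1)%:R).
  under eq_bigr => j _ do rewrite left_mx_table mxE mulr_suml.
  rewrite exchange_big; apply: eq_bigr => p _.
  rewrite -[proj3 0 y p.1.1.2]sum_proj3 mulr_sumr !mulr_suml.
  by apply: eq_bigr => j _; ring.
elim: ps => [|p ps IHps]; last by rewrite big_cons proj3_add3 proj3_at3 IHps.
by rewrite big_nil; case: k => -[|[|[|]]].
Qed.

Lemma sum_diag (a b : nat) : \sum_(k < 3) (a == k.+1)%:R * (b == k.+1)%:R =
  proj3 0 (at3 b 1) a :> F.
Proof.
rewrite !big_ord_recl big_ord0.
by case: a => [|[|[|[|a]]]]; case: b => [|[|[|[|b]]]] /=;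
  rewrite ?mul0r ?mulr0 ?mul1r ?addr0 ?add0r.
Qed.

Lemma proj3_at3Z k a b i : proj3 0 (at3 k (a * b)) i = a * proj3 0 (at3 k b) i.
Proof.
by case: k => [|[|[|[|k]]]]; case: i => [|[|[|[|i]]]] /=; rewrite ?mulr0.
Qed.

Lemma trl_table ps x : \tr (left_mx (table ps) (col3 x)) = ttrl ps x.
Proof.
transitivity (\sum_(p <- ps)
    proj3 0 (at3 p.1.2 (p.2 * proj3 0 x p.1.1.1)) p.1.1.2); last first.
  by elim: ps => [|p ps IHps]; rewrite ?big_nil // big_cons IHps.
rewrite /mxtrace; under eq_bigr => k _ do rewrite left_mx_table.
rewrite exchange_big; apply: eq_bigr => p _.
rewrite -[_ * proj3 _ _ _]mulr1 proj3_at3Z -sum_diag mulr_sumr.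
by apply: eq_bigr => k _; ring.
Qed.

Lemma trr_table ps y : \tr (right_mx (table ps) (col3 y)) = ttrr ps y.
Proof.
transitivity (\sum_(p <- ps)
    proj3 0 (at3 p.1.2 (p.2 * proj3 0 y p.1.1.2)) p.1.1.1); last first.
  by elim: ps => [|p ps IHps]; rewrite ?big_nil // big_cons IHps.
rewrite /mxtrace; under eq_bigr => k _ do rewrite right_mx_table.
rewrite exchange_big; apply: eq_bigr => p _.
rewrite -[_ * proj3 _ _ _]mulr1 proj3_at3Z -sum_diag mulr_sumr.
by apply: eq_bigr => k _; ring.
Qed.

Lemma pair_row_col x y : (row3 x *m col3 y) 0 0 = tpair x y.
Proof. by rewrite mxE !big_ord_recl big_ord0 !mxE /tpair addr0 addrA. Qed.

Lemma mx_seval_table ps (x xi : nat -> F * F * F) f :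
  mx_seval (table ps) (fun i => col3 (x i)) (fun i => row3 (xi i)) f =
  teval ps x xi f.
Proof.
have mx_vevalE u : veval (vmul (table ps)) (fun i => col3 (x i)) u =
    col3 (veval (tmul ps) x u).
  by elim: u => [//|u IHu v IHv] /=; rewrite IHu IHv vmul_table.
rewrite /mx_seval /teval.
elim: f => [//|i u|u|u|f IHf g IHg|f IHf g IHg] /=; rewrite ?IHf ?IHg //;
  rewrite mx_vevalE.
- exact: pair_row_col.
- exact: trl_table.
- exact: trr_table.
Qed.

Lemma satisfies_table ps f :
  satisfies (table ps) f <->
  forall x xi : nat -> F * F * F, teval ps x xi f = 0.
Proof.
split=> [sat_f x xi | f0 x xi]; first by rewrite -mx_seval_table.
rewrite -(f0 (fun i => (x i 0 0, x i 1 0, x i 2 0))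
  (fun i => (xi i 0 0, xi i 0 1, xi i 0 2))) -mx_seval_table.
by apply: eq_seval => i; [exact: col3K | exact: row3K].
Qed.

End Coordinates.

(** * Degeneration along a one-parameter family of bases *)

Section Degenerations.
Variable F : numFieldType.
Local Notation product := (nat * nat * nat * F)%type.
Local Notation triple := (F * F * F)%type.
Implicit Types (ps : seq product) (qs : seq (product * nat)) (x y : triple).
Implicit Types (v : triple * triple * triple).

Definition scale3 (a : F) x : triple := (a * x.1.1, a * x.1.2, a * x.2).

Definition comb3 v x : triple :=
  add3 (scale3 x.1.1 v.1.1) (add3 (scale3 x.1.2 v.1.2) (scale3 x.2 v.2)).

Definition det3 v : F :=
  let: ((a1, a2, a3), (b1, b2, b3), (c1, c2, c3)) := v in
  a1 * (b2 * c3 - b3 * c2) - a2 * (b1 * c3 - b3 * c1)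
  + a3 * (b1 * c2 - b2 * c1).

Definition mx3 v : 'M[F]_3 :=
  \matrix_(k < 3, i < 3) proj3 0 (proj3 (0, 0, 0) v i.+1) k.+1.

Lemma mx3_col3 v x : mx3 v *m col3 x = col3 (comb3 v x).
Proof.
apply/colP => k; rewrite !mxE !big_ord_recl big_ord0 !mxE /=.
by case: k => -[|[|[|//]]] _ /=; ring.
Qed.

Lemma det_mx3 v : \det (mx3 v) = det3 v.
Proof.
case: v => -[[[a1 a2] a3] [[b1 b2] b3]] [[c1 c2] c3].
rewrite (expand_det_row _ ord0) !big_ord_recl big_ord0 /cofactor.
rewrite !(expand_det_row _ ord0) !big_ord_recl !big_ord0 /cofactor !det_mx11.
by rewrite !mxE /=; ring.
Qed.

(** An element [(i, j, k, c, n)] of [qs] adds [c t^n e_k] to the product of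
    [e_i] and [e_j]. *)
Definition deform ps qs (t : F) : seq product :=
  ps ++ [seq (q.1.1, q.1.2 * t ^+ q.2) | q <- qs].

Lemma table_cat ps1 ps2 i :
  table (ps1 ++ ps2) i = table ps1 i + table ps2 i.
Proof. by rewrite !ffunE big_cat. Qed.

(** For [t != 0] the basis [v t] identifies the algebra [ps] with the deformation
    of [ps'] by [qs], whose value at [t = 0] is [ps'] as all exponents in [qs]
    are positive. *)
Lemma degeneration ps ps' qs (v : F -> triple * triple * triple)
    (c : F) (n : nat) :
  c != 0 -> (forall t, det3 (v t) = c * t ^+ n) ->
  all (fun q => 0 < q.2)%N qs ->
  (forall t x y, tmul ps (comb3 (v t) x) (comb3 (v t) y) =
     comb3 (v t) (tmul (deform ps' qs t) x y)) ->
  zariski_closure (in_orbit (table ps)) (table ps').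
Proof.
move=> c0 detv /allP qs_pos vmor; pose m t := table (deform ps' qs t).
have -> : table ps' = m 0.
  apply/ffunP => i; rewrite table_cat -[LHS]addr0; congr (_ + _).
  rewrite ffunE big_seq_cond big1 // => _ /andP[/mapP[q /qs_pos q0 ->] _].
  by rewrite /= expr0n eqn0Ngt q0 mulr0.
apply: curve_closure => [i | t t0].
  have alg := horner_algebra F.
  apply: (falg_ext alg (fun t => esym (table_cat _ _ i))).
  apply: (falg_add alg); first exact: falg_const alg _.
  pose f q t := if q.1.1 == (i.1.1.+1, i.1.2.+1, i.2.+1)
    then q.1.2 * t ^+ q.2 else 0 : F.
  apply: (falg_ext alg (f := fun t => \sum_(q <- qs) f q t)).
    by move=> t; rewrite ffunE big_map [RHS]big_mkcond.
  apply: (falg_sum alg) => q; rewrite /f; case: (_ == _); last first.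
    exact: falg_const alg _.
  by exists (q.1.2 *: 'X^(q.2)) => t; rewrite hornerZ hornerXn.
have vU : mx3 (v t) \in unitmx.
  by rewrite unitmxE det_mx3 detv unitfE mulf_neq0 ?expf_neq0.
exists (mx3 (v t)) => //; apply: act_unique => // x y.
by rewrite (col3K x) (col3K y) !mx3_col3 !vmul_table mx3_col3 vmor.
Qed.

End Degenerations.

(** Structure vectors are recovered from the algebras that they define, and
    changes of basis of [V] act as matrices do, so the basis [e] disappears. *)
Lemma degenerates_closure (R : realType) (V : vectType R[i]) (e : 3.-tuple V)
    (g h : alg3 R) : basis_of fullv e ->
  degenerates e (alg3_algebra e g) (alg3_algebra e h) <->
  zariski_closure (in_orbit (table (products g))) (table (products h)).
Proof.
move=> he; rewrite /degenerates !structure_vector_algebra_of //.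
by split=> gh Z ZC Zg; apply: (gh Z ZC) => _ [a aU ->]; apply: Zg; exists a => //;
  rewrite change_basis_act.
Qed.

(** * The arrows are degenerates_toerations *)

(** Unfolds the evaluation on triples, leaving polynomial expressions in the
    scalars for [ring] and [field]. *)
Ltac expand_coordinates := cbv beta iota zeta delta
  [teval tmul tpair ttrl ttrr seval veval add3 scale3 comb3 det3 at3 proj3
   deform foldr map cat nth products fst snd].

Section Arrows.
Variable R : realType.
Local Notation C := R[i].
Implicit Types g h : alg3 R.

Definition degenerates_to g h :=
  zariski_closure (in_orbit (table (products g))) (table (products h)).

(** The determinant of [basis_at t] is [det_coef * t ^+ det_exp]. *)
Record contraction := Contraction {
  basis_at : C -> (C * C * C) * (C * C * C) * (C * C * C);
  det_coef : C;
  det_exp : nat;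
  extra_products : seq (nat * nat * nat * C * nat)
}.

Local Notation en i j k c n := (i%N, j%N, k%N, c : C, n%N).

(** The families of bases.  Three patterns recur.  Rescaling by [t] some basis
    vectors makes their products disappear in the limit.  Taking a basis
    [v, v^2] or [v, v^2, v^3] of powers of a generator that tends to a nilpotent
    element makes the algebra tend to a nilpotent one; the extra products are
    then the reductions of higher powers by the equation of [v], such as
    [(v - t)^3 = 0] for [C6] to [C5].  For the arrows to [A2] and from [A6] to
    [L1] the basis contains [t] times an idempotent [u] and a sum of two
    eigenvectors of multiplication by [u] with different eigenvalues, and one of
    these, multiplied by [t], becomes the product [e1] of the limit. *)
Definition contract g h : contraction :=
  match g, h with
  | C11, C9 =>
      Contraction (fun t => ((1, 0, 1), (0, 1, 0), (0, 0, t)))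
        1 1 [:: en 3 3 3 1 1]
  | C11, C10 =>
      Contraction (fun t => ((1, 0, 0), (0, 1, 0), (0, 0, t)))
        1 1 [:: en 3 3 3 1 1]
  | C10, C7 =>
      Contraction (fun t => ((1, 1, 0), (0, t, 0), (0, 0, 1)))
        1 1 [:: en 2 2 2 1 1]
  | C10, C8 =>
      Contraction (fun t => ((1, 0, 0), (0, t, 1), (0, t ^+ 2, 0))) (-1) 2
      [:: en 2 3 3 1 1; en 3 2 3 1 1; en 3 3 3 1 2]
  | C9, C6 =>
      Contraction (fun t => ((1, 1, 0), (0, t, 1), (0, t ^+ 2, 0))) (-1) 2
      [:: en 2 3 3 1 1; en 3 2 3 1 1; en 3 3 3 1 2]
  | C9, C7 => Contraction (fun t => ((1, 0, 0), (0, 0, 1), (0, t, 0))) (-1) 1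
      [:: en 3 3 3 1 1]
  | C9, C8 =>
      Contraction (fun t => ((0, 1, 0), (t, 0, 1), (t ^+ 2, 0, 2 * t))) (-1) 2
      [:: en 2 3 3 2 1; en 2 3 2 (-1) 2; en 3 2 3 2 1; en 3 2 2 (-1) 2;
          en 3 3 3 3 2; en 3 3 2 (-2) 3]
  | C6, C2 =>
      Contraction (fun t => ((1, 0, 0), (0, t, 0), (0, 0, 1)))
        1 1 [:: en 2 2 3 1 2]
  | C6, C5 =>
      Contraction (fun t => ((t, 1, 0), (t ^+ 2, 2 * t, 1), (t ^+ 3, 3 * t ^+ 2, 3 * t)))
        1 3
      [:: en 1 3 3 3 1; en 1 3 2 (-3) 2; en 1 3 1 1 3;
          en 3 1 3 3 1; en 3 1 2 (-3) 2; en 3 1 1 1 3;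
          en 2 2 3 3 1; en 2 2 2 (-3) 2; en 2 2 1 1 3;
          en 2 3 3 6 2; en 2 3 2 (-8) 3; en 2 3 1 3 4;
          en 3 2 3 6 2; en 3 2 2 (-8) 3; en 3 2 1 3 4;
          en 3 3 3 10 3; en 3 3 2 (-15) 4; en 3 3 1 6 5]
  | C7, C5 =>
      Contraction (fun t => ((t, 1, 1), (t ^+ 2, 2 * t, 0), (t ^+ 3, 3 * t ^+ 2, 0)))
        1 4
      [:: en 1 3 3 2 1; en 1 3 2 (-1) 2; en 3 1 3 2 1; en 3 1 2 (-1) 2;
          en 2 2 3 2 1; en 2 2 2 (-1) 2;
          en 2 3 3 3 2; en 2 3 2 (-2) 3; en 3 2 3 3 2; en 3 2 2 (-2) 3;
          en 3 3 3 4 3; en 3 3 2 (-3) 4]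
  | C8, C4 =>
      Contraction (fun t => ((1, 0, 0), (0, t, 0), (0, 0, 1)))
        1 1 [:: en 2 2 3 1 2]
  | C8, C5 =>
      Contraction (fun t => ((t, 1, 0), (t ^+ 2, 0, 1), (t ^+ 3, 0, 0))) 1 3
      [:: en 1 3 3 1 1; en 3 1 3 1 1; en 2 2 3 1 1;
          en 2 3 3 1 2; en 3 2 3 1 2; en 3 3 3 1 3]
  (* The isotropic vectors [v2 + i v3] and [v2 - i v3] of the form defining C3
     are multiples of the square of the generator and of the generator. *)
  | C5, C3 =>
      Contraction (fun t => ((0, 0, 4 * t), (2 * t, 1, 0), (2 * 'i * t, - 'i, 0)))
        (- 16 * 'i) 2
      [:: en 2 2 2 2 2; en 2 2 3 (2 * 'i) 2;
          en 3 3 2 (-2) 2; en 3 3 3 (- (2 * 'i)) 2;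
          en 2 3 2 (2 * 'i) 2; en 2 3 3 (-2) 2;
          en 3 2 2 (2 * 'i) 2; en 3 2 3 (-2) 2]
  (* In A1 the idempotents are [(e1 - e3) / 2] and [(e1 + e3) / 2]; one of them
     is kept, the other one is scaled by [2 t]. *)
  | A1, A9 =>
      Contraction (fun t => ((t, 0, t), (0, 1, 0), (2^-1, 0, - 2^-1))) (-1) 1
      [:: en 1 1 1 2 1; en 2 1 2 2 1]
  | A1, A10 =>
      Contraction (fun t => ((t, 0, -t), (0, 1, 0), (2^-1, 0, 2^-1))) 1 1
      [:: en 1 1 1 2 1; en 1 2 2 2 1]
  | A1, C2 => Contraction (fun t => ((1, 0, 0), (0, 1, 0), (0, 0, t))) 1 1
      [:: en 2 3 2 1 1; en 3 2 2 (-1) 1; en 3 3 1 1 2]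
  | A11, A9 | A12, A10 =>
      Contraction (fun t => ((t, 0, 0), (0, 1, 0), (0, 0, 1))) 1 1
      [:: en 1 1 1 1 1]
  | A11, A8 | A12, A7 =>
      Contraction (fun t => ((t, 0, 0), (1, 0, 1), (0, 1, 0))) (-1) 1
      [:: en 1 1 1 1 1]
  | A11, C4 => Contraction (fun t => ((1, 0, 0), (0, 1, 0), (0, 0, t))) 1 1
      [:: en 3 2 2 1 1; en 3 3 3 1 1]
  | A12, C4 => Contraction (fun t => ((1, 0, 0), (0, 1, 0), (0, 0, t))) 1 1
      [:: en 2 3 2 1 1; en 3 3 3 1 1]
  | A7, A2 => Contraction (fun t => ((0, 0, t), (0, t, 0), (1, 0, -1))) (-1) 2
      [:: en 2 3 3 1 1; en 3 2 3 1 1; en 2 2 2 1 1; en 1 2 1 1 1]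
  | A8, A2 => Contraction (fun t => ((0, 0, t), (1, 0, -1), (0, t, 0))) 1 2
      [:: en 2 3 2 1 1; en 3 2 2 1 1; en 3 1 1 1 1; en 3 3 3 1 1]
  | A9, A2 => Contraction (fun t => ((0, t, 0), (0, 0, t), (1, 1, 0))) 1 2
      [:: en 2 2 2 1 1; en 2 1 1 1 1]
  | A10, A2 => Contraction (fun t => ((0, t, 0), (1, 1, 0), (0, 0, t))) (-1) 2
      [:: en 3 3 3 1 1; en 1 3 1 1 1]
  | A3 kappa, C1 => Contraction (fun t => ((1, 0, 0), (0, t, 0), (0, 0, 1))) 1 1
      [:: en 2 2 1 1 2; en 3 2 1 (val kappa) 1]
  (* For [kappa = 2] the symmetric part of the form has rank one; [v2] spans
     its kernel. *)
  | A3 _, L1 =>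
      Contraction (fun t => ((t, 0, 0), (0, 1, -1), (0, 0, -t))) (-1) 2
      [:: en 3 3 1 1 1]
  | A6, L1 => Contraction (fun t => ((t, 0, 0), (0, t, 0), (1, 0, 1))) 1 2
      [:: en 3 2 3 1 1; en 2 2 2 1 1; en 2 1 1 1 1]
  | C2, C1 =>
      Contraction (fun t => ((- t ^+ 2, 0, 0), (0, 1, 0), (t, 0, 1))) (-1) 2
      [:: en 3 3 3 2 1; en 1 1 1 (-1) 2; en 1 2 2 (-1) 2; en 2 1 2 (-1) 2;
          en 1 3 3 (-1) 2; en 3 1 3 (-1) 2; en 2 3 2 1 1; en 3 2 2 1 1]
  | C3, C1 =>
      Contraction (fun t => ((1, 0, 0), (0, t, 0), (0, 0, 1)))
        1 1 [:: en 2 2 1 1 2]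
  | C4, C1 =>
      Contraction (fun t => ((t ^+ 2, 0, 0), (0, 0, 1), (t, 1, 0))) (-1) 2
      [:: en 1 3 1 1 1; en 3 1 1 1 1; en 1 1 1 1 2]
  | A2, C1 =>
      Contraction (fun t => ((1, 0, 0), (0, t, 0), (0, 1, 1)))
        1 1 [:: en 2 3 1 1 1]
  | _, _ => Contraction (fun t => ((t, 0, 0), (0, t, 0), (0, 0, t))) 1 3
      [seq (p, 1%N) | p <- products g]
  end.

Lemma arrow_degenerates g h : arrow g h -> degenerates_to g h.
Proof.
have i2 : ('i * 'i : C) = -1 by rewrite -expr2 sqrCi.
have i_neq0 : 'i != 0 :> C := neq0Ci C.
move=> gh; apply: (@degeneration _ _ _ (extra_products (contract g h))
  (basis_at (contract g h)) (det_coef (contract g h))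
  (det_exp (contract g h))).
- by case: g gh => [|||||||||||||||kappa|||||||||]; case: h => //= _;
    rewrite ?mulf_neq0 ?oppr_eq0 ?oner_eq0 ?pnatr_eq0.
- move=> t.
  by case: g gh => [|||||||||||||||kappa|||||||||]; case: h => //= _;
    expand_coordinates; field: i2.
- by case: g gh => [|||||||||||||||kappa|||||||||]; case: h.
- move=> t [[x1 x2] x3] [[y1 y2] y3].
  (* The only arrow with a condition is [A3 kappa] to [L1], which requires
     [kappa = 2]. *)
  by case: g gh => [|||||||||||||||kappa|||||||||]; case: h => //=;
    try move=> /eqP ->; try move=> _;
    expand_coordinates; congr (_, _, _); field: i2.
Qed.

End Arrows.

(** * Invariants separating the algebras *)

Declare Scope invariant_scope.
Local Infix "+" := Add : invariant_scope.
Local Infix "*" := Mul : invariant_scope.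
Local Notation "u %* v" := (Prod u v) (at level 35) : invariant_scope.

Section InvariantList.
Variable F : fieldType.
Implicit Types (a b c n : F) (l r : F * F) (u v : vterm).
Local Open Scope invariant_scope.
Local Notation x := (Var 0).
Local Notation y := (Var 1).
Local Notation z := (Var 2).
Local Notation w := (Var 3).
Local Notation xi := (Pair F 0).

Definition minus (f g : sterm F) : sterm F := f + Cst (-1)%R * g.
Local Infix "-" := minus : invariant_scope.

Definition trace_form a b u : sterm F := Cst a * TrL F u + Cst b * TrR F u.

Definition trace_relation a b := trace_form a b x.

Definition multiplicative n a b :=
  Cst n * trace_form a b (x %* y) - trace_form a b x * trace_form a b y.

Definition commutator := xi (x %* y) - xi (y %* x).

Definition square n a := Cst n * xi (x %* x) - Cst a * TrL F x * xi x.

(** A component of [n uv - psi(u) v - phi(v) u], where [psi] and [phi] are the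
    combinations of the two trace forms with coefficients [l] and [r]. *)
Definition defect n l r u v := Cst n * xi (u %* v)
  - trace_form l.1 l.2 u * xi v - trace_form r.1 r.2 v * xi u.

Definition no_defect n l r := defect n l r x y.

Definition rank1_defect n l r :=
  defect n l r x y * defect n l r z w - defect n l r x w * defect n l r z y.

Definition triple_product := xi ((x %* y) %* z).

Definition trace_power (k : nat) := TrL F (iter k.-1 (Prod x) x).
Local Notation p := trace_power.

(** By Newton's identities this is six times the determinant of [L_x], expressed
    by the power sums of its eigenvalues. *)
Definition singular := p 1 * p 1 * p 1 - Cst 3 * p 1 * p 2 + Cst 2 * p 3.

(** The Hankel determinant of the power sums [3, p 1, p 2, p 3, p 4], which is the
    discriminant of the characteristic polynomial of [L_x]. *)
Definition multiple_root :=
  Cst 3 * (p 2 * p 4 - p 3 * p 3) - p 1 * (p 1 * p 4 - p 2 * p 3)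
  + p 2 * (p 1 * p 3 - p 2 * p 2).

(** In a two-dimensional space the square of an alternating form at [(x, y)] and
    the Gram determinant of a bilinear form at [(x, y)] change by the same factor
    with the basis [(x, y)]; here their ratio is required to be [c ^ 2]. *)
Definition form_invariant c :=
  (xi (x %* y) - xi (y %* x)) * (xi (x %* y) - xi (y %* x))
  - Cst (c * c)%R * (xi (x %* x) * xi (y %* y) - xi (x %* y) * xi (y %* x)).

End InvariantList.

Ltac expand_invariant := cbv beta iota zeta delta
  [iter Nat.pred minus trace_form trace_relation multiplicative commutator
   square defect no_defect rank1_defect triple_product trace_power singular
   multiple_root form_invariant]; expand_coordinates.

Section Table.
Variable R : realType.
Local Notation C := R[i].
Implicit Types g h : alg3 R.

Definition sat g (f : sterm C) := satisfies (table (products g)) f.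

Ltac saturate :=
  let x := fresh "x" in let xi := fresh "xi" in
  apply/satisfies_table => x xi;
  expand_invariant;
  case: (x 0%N) => [[x1 x2] x3]; case: (x 1%N) => [[y1 y2] y3];
  case: (x 2%N) => [[z1 z2] z3]; case: (x 3%N) => [[w1 w2] w3];
  case: (xi 0%N) => [[t1 t2] t3]; cbv beta iota zeta delta [fst snd]; ring.

Definition commutative g : bool :=
  match g with
  | C1 | C2 | C3 | C4 | C5 | C6 | C7 | C8 | C9 | C10 | C11 => true
  | _ => false
  end.

Lemma sat_commutator g : commutative g -> sat g (commutator C).
Proof. by case: g => // _; saturate. Qed.

(** For instance [A1] is the algebra of upper triangular 2 x 2 matrices: its
    diagonal characters [a] and [d] satisfy [3 a = 2 t - s], [3 d = 2 s - t] and
    [(x - a(x)) (y - d(y)) = 0], so that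
    [xy - a(x) y - d(y) x = - a(x) d(y) 1] has rank one.  In the other algebras
    the corrected product is likewise a fixed vector times a product of two
    linear forms, except that in [A9] and [A10] only each component of the
    product is of this kind. *)
Definition rank1_param g : option (C * (C * C) * (C * C)) :=
  match g with
  | C1 | C4 | A2 | A9 | A10 => Some (1, (0, 0), (0, 0))
  | C2 => Some (3, (1, 0), (1, 0))
  | A1 => Some (3, (2, -1), (-1, 2))
  | A7 => Some (3, (0, 0), (0, 1))
  | A8 => Some (3, (1, 0), (0, 0))
  | A11 => Some (1, (1, -1), (0, 0))
  | A12 => Some (1, (0, 0), (-1, 1))
  | _ => None
  end.

Lemma sat_rank1_defect g n l r : rank1_param g = Some (n, l, r) ->
  sat g (rank1_defect n l r).
Proof. by case: g => //= -[<- <- <-]; saturate. Qed.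

Definition trace_invariants g : seq (sterm C) :=
  match g with
  | C1 | C3 | C5 | A2 | A3 _ => [:: trace_relation 1 0]
  | C2 | C6 => [:: multiplicative 3 1 0]
  | C7 => [:: multiplicative 2 1 0]
  | C4 | C8 => [:: multiplicative 1 1 0]
  | A1 => [:: multiplicative 3 2 (-1)]
  | A7 => [:: trace_relation 3 (-2)]
  | A8 => [:: trace_relation 2 (-3)]
  | A9 => [:: trace_relation 1 (-2)]
  | A10 => [:: trace_relation 2 (-1)]
  | A11 => [:: multiplicative 1 1 (-1); multiplicative 1 (-1) 2]
  | A12 => [:: multiplicative 1 (-1) 1; multiplicative 1 2 (-1)]
  | _ => [::]
  end.

(** Beyond the end of the list the expression is the constant 0. *)
Definition all_sat g fs := forall i, sat g (nth (Cst 0) fs i).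

Lemma sat_trace_invariants g : all_sat g (trace_invariants g).
Proof.
move=> [|[|i]]; case: g => [|||||||||||||||kappa|||||||||];
  cbn [nth trace_invariants]; rewrite ?nth_nil; saturate.
Qed.

Definition other_invariants g : seq (sterm C) :=
  match g with
  | A0 => [:: no_defect 1 (0, 0) (0, 0)]
  | A4 => [:: no_defect 3 (1, 0) (0, 0)]
  | A5 => [:: no_defect 3 (0, 0) (0, 1)]
  | L1 => [:: square 1 0]
  | A6 => [:: square 2 1]
  | C3 => [:: triple_product C]
  | A3 kappa => [:: triple_product C; form_invariant (val kappa)]
  | C9 => [:: multiple_root C]
  | C10 => [:: singular C]
  | _ => [::]
  end.

Lemma sat_other_invariants g : all_sat g (other_invariants g).
Proof.
move=> [|[|i]]; case: g => [|||||||||||||||kappa|||||||||];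
  cbn [nth other_invariants]; rewrite ?nth_nil; saturate.
Qed.

(** The tables below contain, for each [g], only enough algebras [h] that every
    algebra not below [g] has one of them below it. *)
Definition noncommuting h : bool :=
  match h with L1 | A2 | A3 _ | A4 | A5 => true | _ => false end.

Definition higher_rank h : bool :=
  match h with L1 | C3 | A3 _ => true | _ => false end.

Definition trace_separated g h : bool :=
  match g, h with
  | (C1 | C3), (C2 | C4)
  | C5, (C2 | C4 | C7)
  | C2, C4
  | C4, C2
  | C6, (C4 | C7)
  | C7, (C2 | C4)
  | C8, (C2 | C7)
  | A1, (C4 | A4 | A5 | A7 | A8)
  | A2, (C2 | C4 | A4 | A5 | A7 | A8 | A9 | A10)
  | A3 _, (C2 | C4 | A4 | A5 | A6)
  | A7, (C2 | C4 | A4 | A5 | A8 | A9 | A10)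
  | A8, (C2 | C4 | A4 | A5 | A7 | A9 | A10)
  | A9, (C2 | C4 | A4 | A5 | A7 | A8 | A10)
  | A10, (C2 | C4 | A4 | A5 | A7 | A8 | A9)
  | A11, (C2 | A4 | A5 | A7 | A10)
  | A12, (C2 | A4 | A5 | A8 | A9) => true
  | _, _ => false
  end.

Definition other_separated g h : bool :=
  match g, h with
  | A0, (L1 | C1 | A4 | A5)
  | A4, (L1 | C1 | A5)
  | A5, (L1 | C1 | A4)
  | L1, (C1 | A4 | A5 | A6)
  | A6, (C1 | A4 | A5)
  | C3, C5
  | A3 _, (C3 | C5 | A2)
  | C9, C10
  | C10, C2 => true
  | A3 kappa, L1 => val kappa != 2
  | A3 kappa, A3 kappa' => val kappa != val kappa'
  | _, _ => false
  end.

Definition separated g h : bool :=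
  [|| commutative g && noncommuting h, rank1_param g && higher_rank h,
      trace_separated g h | other_separated g h].

Lemma inK_neq0 (kappa : C) : inK kappa -> kappa != 0.
Proof. by apply: contraTneq => ->; rewrite /inK /= !ltxx andbF. Qed.

(** The half plane [inK] contains only one of two opposite numbers. *)
Lemma inK_sqr_inj (k k' : C) : inK k -> inK k' -> k * k = k' * k' -> k = k'.
Proof.
move=> Kk Kk' /eqP; rewrite -!expr2 eqf_sqr => /orP[/eqP //|/eqP kk'].
move: Kk Kk'; rewrite kk' /inK; case: k' {kk'} => a b /=.
by rewrite oppr_eq0 !oppr_gt0; case: (ltgtP a 0) => //= _; case: ltgtP.
Qed.

Lemma inK2 : inK (2 : C).
Proof. by rewrite /inK /= addr_gt0 /= ?ltr01. Qed.

Lemma separating f g h : sat g f -> ~ sat h f -> ~ degenerates_to g h.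
Proof. by move=> gf hf gh; apply/hf/(satisfies_closure gh). Qed.

(** Closes the goal when [val0] says that a closed expression of value [c] is
    zero. *)
Ltac conclude_nonzero val0 c :=
  have /eqP : c = 0 :> C by [refine (etrans _ val0); ring];
  by rewrite ?oppr_eq0 ?oner_eq0 ?pnatr_eq0.

(** Substitutes the basis vector of index [nth 0 ks i] for the [i]-th vector
    variable and the coordinate form of index [k] for the covectors. *)
Ltac evaluate_at ks k :=
  move/satisfies_table =>
    /(_ (fun i => at3 (nth 0%N ks i) 1) (fun=> at3 k 1));
  cbv beta iota delta [trace_invariants other_invariants]; expand_invariant.

Ltac refute_at ks k :=
  let val0 := fresh "val0" in evaluate_at ks k => val0;
  first [ conclude_nonzero val0 (1 : C) | conclude_nonzero val0 (-1 : C)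
        | conclude_nonzero val0 (2 : C) | conclude_nonzero val0 (-2 : C)
        | conclude_nonzero val0 (3 : C) | conclude_nonzero val0 (-3 : C)
        | conclude_nonzero val0 (4 : C) | conclude_nonzero val0 (-4 : C)
        | conclude_nonzero val0 (5 : C) | conclude_nonzero val0 (-5 : C)
        | conclude_nonzero val0 (6 : C) | conclude_nonzero val0 (-6 : C)
        | conclude_nonzero val0 (7 : C) | conclude_nonzero val0 (-7 : C)
        | conclude_nonzero val0 (9 : C) | conclude_nonzero val0 (-10 : C) ].

Lemma commutator_separates g h :
  commutative g -> noncommuting h -> ~ degenerates_to g h.
Proof.
move=> /sat_commutator/separating sep.
case: h => [|||||||||||||||kappa|||||||||] // _;
  apply: sep;
  first [ refute_at ([:: 2; 3]%N) 1%N | refute_at ([:: 2; 3]%N) 2%N | idtac ].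
(* There remains [A3 kappa], where [e3 e2 - e2 e3 = kappa e1]. *)
evaluate_at ([:: 2; 3]%N) 1%N => k0; have /eqP[] := inK_neq0 (valP kappa).
by apply/oppr_inj; rewrite oppr0 -k0; ring.
Qed.

Lemma rank1_separates g h :
  rank1_param g -> higher_rank h -> ~ degenerates_to g h.
Proof.
case Eg: (rank1_param g) => [[[n l] r]|] // _.
have /separating sep := sat_rank1_defect Eg.
case: h => [|||||||||||||||kappa|||||||||] // _; apply: sep;
  case: g Eg => //= -[<- <- <-];
  refute_at ([:: 2; 2; 3; 3]%N) 1%N.
Qed.

Ltac refute_at_diagonal :=
  first [ refute_at ([:: 1; 1; 1]%N) 1%N | refute_at ([:: 2; 2; 2]%N) 2%N
        | refute_at ([:: 3; 3; 3]%N) 3%N ].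

(** The second algebra of each pair has an idempotent basis vector, on which the
    values of [t] and [s] violate an invariant of the first. *)
Lemma trace_separates g h : trace_separated g h -> ~ degenerates_to g h.
Proof.
move=> gh; have sep i := separating (@sat_trace_invariants g i).
case: g sep gh => [|||||||||||||||kappa|||||||||] sep; case: h => //= _;
  first [ apply: (sep _ 0%N); refute_at_diagonal
        | apply: (sep _ 1%N); refute_at_diagonal ].
Qed.

Ltac refute_other :=
  first [ refute_at_diagonal | refute_at ([:: 3; 3]%N) 1%N
        | refute_at ([:: 1; 1; 1]%N) 3%N | refute_at ([:: 2; 3]%N) 1%N ].

Lemma other_separates g h : other_separated g h -> ~ degenerates_to g h.
Proof.
move=> gh; have sep i := separating (@sat_other_invariants g i).
case: g sep gh => [|||||||||||||||k|||||||||] sep;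
  case: h => [|||||||||||||||k'|||||||||] //= gh;
  try solve [apply: (sep _ 0%N); refute_other].
- (* [C9] against [C10]: at [e1 + 2 e2] the operator [L_x] of [C10] has the
     distinct eigenvalues 1, 2 and 0. *)
  apply: (sep _ 0%N).
  move/satisfies_table => /(_ (fun=> (1, 2, 0)) (fun=> at3 1 1)).
  cbv beta iota delta [other_invariants]; expand_invariant => val0.
  conclude_nonzero val0 (4 : C).
- (* [L1] has the invariant ratio 4. *)
  apply: (sep _ 1%N); evaluate_at ([:: 2; 3]%N) 1%N => val0.
  case/eqP: gh; apply: inK_sqr_inj (valP k) inK2 _.
  by apply/subr0_eq/oppr_inj; rewrite oppr0 -val0; ring.
- (* [C3] has the invariant ratio 0. *)
  apply: (sep _ 1%N); evaluate_at ([:: 2; 3]%N) 1%N => val0.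
  have /eqP[] : val k ^+ 2 != 0 by rewrite expf_neq0 // inK_neq0 // (valP k).
  by apply/oppr_inj; rewrite oppr0 -val0; ring.
- by apply: (sep _ 1%N); refute_at ([:: 2; 3]%N) 1%N.
- apply: (sep _ 1%N); evaluate_at ([:: 2; 3]%N) 1%N => val0.
  case/eqP: gh; apply: inK_sqr_inj (valP k) (valP k') _.
  by apply/subr0_eq/oppr_inj; rewrite oppr0 -val0; ring.
Qed.

Lemma separatedP g h : separated g h -> ~ degenerates_to g h.
Proof.
case/or4P => [/andP[]|/andP[]||]; first exact: commutator_separates.
- exact: rank1_separates.
- exact: trace_separates.
- exact: other_separates.
Qed.

End Table.

(** * The graph *)

Section Classification.
Variable R : realType.
Implicit Types g h k : alg3 R.

Definition below g h := g = h \/ directed_path g h.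

Lemma below_arrow g k h : arrow g k -> below k h -> below g h.
Proof.
move=> gk [<-|[p [_ pp lp]]]; right; first by exists [:: k]; rewrite /= gk.
by exists (k :: p); rewrite /= gk.
Qed.

Lemma below_degenerates g h : below g h -> degenerates_to g h.
Proof.
case=> [->|[p [_ pp <-]]].
  by move=> Z _ ZA; apply/ZA/in_orbit_refl.
elim: p g pp => [|k p IHp] g /= => [_|/andP[gk kp]].
  by move=> Z _ ZA; apply/ZA/in_orbit_refl.
exact: in_orbit_closure_trans (arrow_degenerates gk) (IHp k kp).
Qed.

(** The vertices at which an arrow ends.  [L1] comes last because the arrow from
    [A3 kappa] to it depends on [kappa] and would block a computation that
    examines it. *)
Definition targets : seq (alg3 R) :=
  [:: A0 R; C1 R; C2 R; C3 R; C4 R; C5 R; C6 R; C7 R; C8 R; C9 R; C10 R;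
      A2 R; A7 R; A8 R; A9 R; A10 R; L1 R].

Fixpoint reaches (n : nat) (P : pred (alg3 R)) g : bool :=
  P g || (if n is m.+1
          then has (fun k => arrow g k && reaches m P k) targets else false).

Lemma has_witness (T : Type) (a : pred T) s : has a s -> exists x, a x.
Proof. by elim: s => //= x s IHs /orP[ax|/IHs]; first by exists x. Qed.

Lemma reachesP n P g : reaches n P g -> exists2 h, below g h & P h.
Proof.
elim: n g => [|n IHn] g /orP[Pg|] //; try by exists g => //; left.
by case/has_witness => k /andP[gk /IHn[h kh Ph]]; exists h => //;
  exact: below_arrow kh.
Qed.

Definition same_alg g h : bool :=
  match g, h with
  | A0, A0 | L1, L1 | C1, C1 | C2, C2 | C3, C3 | C4, C4 | C5, C5 | C6, C6
  | C7, C7 | C8, C8 | C9, C9 | C10, C10 | C11, C11 | A1, A1 | A2, A2 | A4, A4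
  | A5, A5 | A6, A6 | A7, A7 | A8, A8 | A9, A9 | A10, A10 | A11, A11
  | A12, A12 => true
  | A3 kappa, A3 kappa' => val kappa == val kappa'
  | _, _ => false
  end.

Lemma same_algP g h : same_alg g h -> h = g.
Proof.
by case: g => [|||||||||||||||k|||||||||];
  case: h => [|||||||||||||||k'|||||||||] //= /eqP/val_inj ->.
Qed.

(** The longest path of the graph has six arrows. *)
Lemma separated_or_below g h :
  reaches 6 (separated g) h || reaches 6 (same_alg h) g.
Proof.
case: g => [|||||||||||||||k|||||||||];
  case: h => [|||||||||||||||k'|||||||||];
  try (lazy; reflexivity).
(* From [A3 k] to [L1], then from [A3 k] to [A3 k']. *)
- case k2: (val k == 2); apply/orP; [right|left].
    by cbn [reaches has targets arrow same_alg andb orb]; rewrite k2.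
  by cbn [reaches]; rewrite /separated /other_separated k2 !orbT.
- case kk': (val k == val k'); apply/orP; [right|left].
    by cbn [reaches same_alg]; rewrite eq_sym kk'.
  by cbn [reaches]; rewrite /separated /other_separated kk' !orbT.
Qed.

Lemma degenerates_below g h : degenerates_to g h -> below g h.
Proof.
move=> gh; case/orP: (separated_or_below g h) => /reachesP[k].
  move=> /below_degenerates hk /separatedP[].
  exact: in_orbit_closure_trans gh hk.
by move=> gk /same_algP <-.
Qed.

End Classification.

Theorem mainTheorem1 (R : realType) (V : vectType R[i])
    (e : 3.-tuple V) (he : basis_of fullv e) (g h : alg3 R) :
  degenerates e (alg3_algebra e g) (alg3_algebra e h) <->
  g = h \/ directed_path g h.
Proof.
rewrite (degenerates_closure g h he).
by split; [exact: degenerates_below | exact: below_degenerates].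
Qed.
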